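(* Let $\mathbb{K}$ be a field of characteristic zero, $\lambda$ a positive integer, and $d\in\mathbb{K}[x,y,z]$ an irreducible polynomial such that there is a positive integer $m$ with $\sigma_x^m(d)=\sigma_y^n\sigma_z^k(d)$ for some $n,k\in\mathbb{Z}$; let $m$ be the smallest such positive integer and fix such integers $n,k$. Suppose there are no integers $n_1,k_1$ with $n_1>0$ such that $\sigma_y^{n_1}(d)=\sigma_z^{k_1}(d)$. Let $$r=\frac{1}{d^\lambda}\sum_{i=1}^I\sum_{\ell=1}^{m_i}\frac{b_{i,\ell}}{c_i^\ell},$$ where $b_{i,\ell}\in\mathbb{K}[x,y,z]$ with $\deg_z(b_{i,\ell})<\deg_z(d)$, the $c_i\in\mathbb{K}[x,y]$ are pairwise distinct irreducible polynomials with $\deg_y(b_{i,\ell})<\deg_y(c_i)$, and for every $i$ there is no positive integer $t$ with $\sigma_x^{tm}(c_i)=\sigma_y^{tn}(c_i)$. Then $r$ has a telescoper if and only if $r=0$.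
   Context: $\sigma_x,\sigma_y,\sigma_z$ are the shift automorphisms of $\mathbb{K}(x,y,z)$: $\sigma_x(f)=f(x+1,y,z)$, $\sigma_y(f)=f(x,y+1,z)$, $\sigma_z(f)=f(x,y,z+1)$. A rational function $g\in\mathbb{K}(x,y,z)$ is $(\sigma_y,\sigma_z)$-summable if $g=\sigma_y(u)-u+\sigma_z(v)-v$ for some $u,v\in\mathbb{K}(x,y,z)$. A telescoper for $f$ is a nonzero operator $L=\sum_i \ell_i S_x^i$ with $\ell_i\in\mathbb{K}(x)$ such that $L(f)=\sum_i\ell_i f(x+i,y,z)$ is $(\sigma_y,\sigma_z)$-summable. *)

(* Defs.v *)
From HB Require Import structures.
From mathcomp Require Import all_boot all_order all_algebra.
From mathcomp Require Import fraction.
Set Implicit Arguments. Unset Strict Implicit. Unset Printing Implicit Defensive.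
Import Order.TTheory GRing.Theory Num.Theory.
Local Open Scope ring_scope.

(* K[x,y,z] is encoded as nested univariate polynomials
   {poly {poly {poly K}}}: the outermost variable is z, the middle one y,
   the innermost one x.  K[x,y] = {poly {poly K}} (outer y, inner x) and
   K[x] = {poly K}.  K(x,y,z) = {fraction K[x,y,z]}. *)
Notation "x %:F" := (@FracField.tofrac _ x).
Notation Pxy K := {poly {poly K}}.
Notation Pxyz K := {poly {poly {poly K}}}.
Notation Fxyz K := {fraction (Pxyz K)}.

Section Defs.
Variable K : fieldType.

Definition shx (a : K) (p : Pxyz K) : Pxyz K :=
  map_poly (map_poly (fun q : {poly K} => q \Po ('X + a%:P))) p.
Definition shy (a : K) (p : Pxyz K) : Pxyz K :=
  map_poly (fun q : Pxy K => q \Po ('X + (a%:P)%:P)) p.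
Definition shz (a : K) (p : Pxyz K) : Pxyz K :=
  p \Po ('X + ((a%:P)%:P)%:P).

(* extension of a polynomial map to K(x,y,z), via a representative
   numerator/denominator pair (well defined for the shifts, which are
   injective ring endomorphisms) *)
Definition fraclift (f : Pxyz K -> Pxyz K) (g : Fxyz K) : Fxyz K :=
  let r := repr g in (f \n_r)%:F / (f \d_r)%:F.

Definition sigx (g : Fxyz K) := fraclift (shx 1) g.
Definition sigy (g : Fxyz K) := fraclift (shy 1) g.
Definition sigz (g : Fxyz K) := fraclift (shz 1) g.

Definition summable_yz (g : Fxyz K) : Prop :=
  exists u v : Fxyz K, g = sigy u - u + (sigz v - v).

Definition in_Kx (l : Fxyz K) : Prop :=
  exists p q : {poly K}, l = ((p%:P)%:P)%:F / ((q%:P)%:P)%:F.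

Definition apply_op (ls : seq (Fxyz K)) (f : Fxyz K) : Fxyz K :=
  \sum_(i < size ls) ls`_i * iter i sigx f.

Definition has_telescoper (f : Fxyz K) : Prop :=
  exists ls : seq (Fxyz K),
    [/\ (forall l, l \in ls -> in_Kx l), has (fun l => l != 0) ls
      & summable_yz (apply_op ls f)].

End Defs.

Definition irreducible_elt (R : idomainType) (p : R) : Prop :=
  [/\ p != 0, p \isn't a GRing.unit &
      forall a b : R, p = a * b -> a \is a GRing.unit \/ b \is a GRing.unit].

(* deg_y(p) + 1 (and 0 for p = 0) for p in K[x,y,z] *)
Definition sizey (K : fieldType) (p : Pxyz K) : nat :=
  \big[maxn/0%N]_(i < size p) size p`_i.

(* Main.v *)
Require Import Defs.
From HB Require Import structures.
From mathcomp Require Import all_boot all_order all_algebra.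
From mathcomp Require Import fraction.
From mathcomp Require Import generic_quotient ring zify.
From Stdlib Require Import Classical_Prop.
Set Implicit Arguments. Unset Strict Implicit. Unset Printing Implicit Defensive.
Import Order.TTheory GRing.Theory Num.Theory.
Local Open Scope ring_scope.

(** Suppose [L r] is summable, and let [t0] be the order of [L]. Summing over the
    translates of a large box in the [(y, z)]-lattice kills the summable part
    away from the boundary of the box, so the sum of [L r] has no pole at
    [d' = sigma_x^t0 d]. Only the terms of [L r] whose shift is a multiple of the
    period [(m, -n, -k)] contribute a pole there; comparing degrees in [z], their
    numerators satisfy an exact linear relation over [K(x)] between shifts of
    [a = d^lambda r]. By this relation a pole of [a] along some [c_i] propagates to
    infinitely many pairwise non-associate shifts of [c_i], which is impossible.
    So [a] has no pole in [y], and being proper in [y] it vanishes. *)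

(** * Divisibility and unique factorization in integral domains *)

Section Divisibility.
Variable R : idomainType.
Implicit Types p q a b : R.

(** The functions witnessing summability are arbitrary: all that is known of their poles is that a
    denominator has finitely many prime factors. So no partial fractions or pole orders are used. A
    pole at a prime is the failure of [local], and contradictions come from too many distinct primes
    in one denominator, or from a prime dividing something of smaller degree. The coefficients of
    [L] pass through the box sum because they are invariant under shifts in [y] and [z]. The
    stabilizer of [d] in the lattice of all shifts is generated by [(m, -n, -k)], so for each [j] at
    most one translate of [sigma_x^j r] in [y] and [z] has a pole at [d']. Divisibility between
    shifts of an irreducible polynomial gives equality only up to a unit; shifts preserve the
    iterated leading coefficient, which removes the unit and lets hypotheses stated as equalities
    apply. *)

Definition divides p a := exists q, a = q * p.

Definition prime_elt p := p \isn't a GRing.unit /\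
  forall a b, divides p (a * b) -> divides p a \/ divides p b.

(** [mu] is additive and at least 1 on nonzero nonunits, so it bounds the length of factorizations
    without having to equal it; this permits an easy choice for polynomials. *)
Definition ufd := exists mu : R -> nat,
  [/\ forall a b, a != 0 -> b != 0 -> mu (a * b) = (mu a + mu b)%N,
      forall a, a != 0 -> (mu a == 0%N) = (a \is a GRing.unit)
    & forall p, irreducible_elt p -> prime_elt p].

Lemma divides0 p : divides p 0.
Proof. by exists 0; rewrite mul0r. Qed.

Lemma divides_refl p : divides p p.
Proof. by exists 1; rewrite mul1r. Qed.

Lemma divides_mull p a b : divides p b -> divides p (a * b).
Proof. by case=> q ->; exists (a * q); rewrite mulrA. Qed.

Lemma divides_mulr p a b : divides p a -> divides p (a * b).
Proof. by rewrite mulrC; apply: divides_mull. Qed.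

Lemma dividesD p a b : divides p a -> divides p b -> divides p (a + b).
Proof. by case=> q -> [q' ->]; exists (q + q'); rewrite mulrDl. Qed.

Lemma divides_addl p a b : divides p a -> divides p (a + b) -> divides p b.
Proof. by case=> q -> [q' e]; exists (q' - q); rewrite mulrBl -e addrC addKr. Qed.

Lemma prime_ndvd1 p : prime_elt p -> ~ divides p 1.
Proof.
by case=> /negP pU _ [q e]; apply: pU; apply/unitrPr; exists q; rewrite mulrC.
Qed.

(** Primes that do not divide one another each use up at least 1 of [mu q]. The weight [N] makes
    sense of being far away: without a bound, a divisor heavier than all those found so far exists
    and is new. *)
Lemma finite_prime_divisors (T : eqType) (N : T -> nat) (F : T -> R) q :
  ufd -> (forall t, prime_elt (F t)) ->
  (forall t t', t != t' -> ~ divides (F t) (F t')) -> q != 0 ->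
  exists B, forall t, (B <= N t)%N -> ~ divides (F t) q.
Proof.
move=> [mu [muM mu0 _]] pF nF q0; apply: NNPP => noB.
have unbounded B : exists t, (B <= N t)%N /\ divides (F t) q.
  apply: NNPP => H; apply: noB; exists B => t Bt dt.
  by apply: H; exists t.
have long n : exists l : seq T,
    [/\ uniq l, size l = n & forall t, t \in l -> divides (F t) q].
  elim: n => [|n [l [ul sl dl]]]; first by exists [::].
  have [t [Bt dt]] := unbounded (\max_(t <- l) N t).+1.
  exists (t :: l); split=> /=; last 2 [by rewrite sl].
  - rewrite ul andbT; apply/negP => tl.
    by move: Bt; rewrite (big_rem t) //= ltnNge leq_maxl.
  - by move=> t'; rewrite inE => /predU1P [->|/dl].
have bounded : forall (l : seq T) g, g != 0 -> uniq l ->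
    (forall t, t \in l -> divides (F t) g) -> (size l <= mu g)%N.
  elim=> [//|t l IH] g g0 /= /andP [tl ul] dg.
  have [h eg] := dg t (mem_head _ _).
  move: g0; rewrite eg mulf_eq0 negb_or => /andP [h0 Ft0].
  rewrite muM // addnC -add1n leq_add //.
    by rewrite lt0n mu0 //; case: (pF t).
  apply: IH => // t' t'l; have := dg t'; rewrite inE t'l orbT eg => /(_ isT).
  case/(proj2 (pF t')) => // /nF []; apply/eqP => ett.
  by rewrite -ett t'l in tl.
have [l [ul sl dl]] := long (mu q).+1.
by have := bounded l q q0 ul dl; rewrite sl ltnn.
Qed.

End Divisibility.

Lemma prime_irreducible (R : idomainType) (p : R) :
  p != 0 -> prime_elt p -> irreducible_elt p.
Proof.
move=> p0 [pU pp]; split=> // a b e.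
have : divides p (a * b) by rewrite -e; apply: divides_refl.
have aux u v w : p = v * w -> v = u * p -> w \is a GRing.unit.
  move=> ep ev; apply/unitrPr; exists u; apply: (mulIf p0).
  by rewrite mul1r -mulrA -ev mulrC -ep.
case/pp => -[u eu]; [right|left]; first exact: aux e eu.
by apply: aux eu; rewrite e mulrC.
Qed.

Lemma irreducible_polyC (D : idomainType) (c : D) :
  irreducible_elt c%:P -> irreducible_elt c.
Proof.
case; rewrite polyC_eq0 => c0 cU irr; split=> //.
  by apply: contra cU; rewrite poly_unitE size_polyC c0 coefC.
move=> a b /(congr1 polyC); rewrite polyCM => /irr.
by rewrite !poly_unitE !coefC /= => -[/andP []|/andP []]; [left|right].
Qed.

Lemma dividesMX (D : idomainType) (c : D) (f : {poly D}) :
  c != 0 -> divides c%:P (f * 'X) -> divides c%:P f.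
Proof.
move=> c0 [g]; elim/poly_ind: g => [|g a _] e.
  move/eqP: e; rewrite mul0r mulf_eq0 polyX_eq0 orbF => /eqP ->.
  exact: divides0.
have a0 : a = 0.
  move: (congr1 (horner^~ 0) e); rewrite !hornerE ?mulr0 ?add0r => /esym/eqP.
  by rewrite mulf_eq0 (negPf c0) orbF => /eqP.
exists g; apply: (@mulIf _ 'X); first by rewrite polyX_eq0.
by rewrite e a0 addr0 -!mulrA (mulrC 'X).
Qed.

Lemma prime_polyC (D : idomainType) (c : D) :
  c != 0 -> prime_elt c -> prime_elt c%:P.
Proof.
move=> c0 [cU pc]; split; first by rewrite poly_unitE coefC negb_and cU orbT.
elim/poly_ind => [|a a0 IHa]; first by left; apply: divides0.
elim/poly_ind => [|b b0 IHb]; first by right; apply: divides0.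
move=> dab.
have dC u v : divides u v -> divides (u%:P : {poly D}) v%:P.
  by case=> w ->; exists w%:P; rewrite polyCM.
have : divides c (a0 * b0).
  case: dab => g /(congr1 (horner^~ 0)); rewrite !hornerE ?mulr0 ?add0r => ->.
  by exists g.[0].
case/pc => [/dC da|/dC db].
  have : divides c%:P (a * (b * 'X + b0%:P)).
    apply: dividesMX => //; apply: (@divides_addl _ _ (a0%:P * (b * 'X + b0%:P))).
      exact: divides_mulr.
    by rewrite addrC mulrAC -mulrDl.
  case/IHa; last by right.
  by left; apply: dividesD => //; apply: divides_mulr.
have : divides c%:P ((a * 'X + a0%:P) * b).
  apply: dividesMX => //; apply: (@divides_addl _ _ ((a * 'X + a0%:P) * b0%:P)).
    exact: divides_mull.
  by rewrite addrC -mulrA -mulrDr.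
case/IHb; first by left.
by right; apply: dividesD => //; apply: divides_mulr.
Qed.

(* Gauss's lemma: a constant dividing a product splits between the factors. *)
Lemma cancel_const (D : idomainType) (c : D) (p h s : {poly D}) :
  ufd D -> c != 0 -> c%:P * p = h * s ->
  exists c1 c2 h' s', [/\ c = c1 * c2, h = c1%:P * h', s = c2%:P * s'
    & p = h' * s'].
Proof.
move=> [mu [muM mu0 irrp]].
have [N] := ubnP (mu c); elim: N => // N IH in c p h s * => muc c0 e.
have [cU|cU] := boolP (c \is a GRing.unit).
  exists c, 1, (c^-1%:P * h), s; split; rewrite ?mulr1 ?mul1r //.
    by rewrite mulrA -polyCM divrr // mul1r.
  by rewrite -mulrA -e mulrA -polyCM mulVr // mul1r.
case: (classic (irreducible_elt c)) => [irr|nirr].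
  have cP0 : c%:P != 0 by rewrite polyC_eq0.
  have [[h' eh]|[s' es]] :
      divides c%:P h \/ divides c%:P s.
    apply: (proj2 (prime_polyC c0 (irrp _ irr))); exists p.
    by rewrite -e mulrC.
  - exists c, 1, h', s; split; rewrite ?mulr1 ?mul1r //; first by rewrite mulrC.
    by apply: (mulfI cP0); rewrite e eh mulrA (mulrC h').
  - exists 1, c, h, s'; split; rewrite ?mulr1 ?mul1r //; first by rewrite mulrC.
    by apply: (mulfI cP0); rewrite e es [RHS]mulrC mulrA.
have [a [b [ec aU bU]]] :
    exists a b, [/\ c = a * b, a \isn't a GRing.unit & b \isn't a GRing.unit].
  apply: NNPP => H; apply: nirr; split=> // a b ec.
  have [aU|aU] := boolP (a \is a GRing.unit); first by left.
  have [bU|bU] := boolP (b \is a GRing.unit); first by right.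
  by case: H; exists a, b.
have [a0 b0] : a != 0 /\ b != 0.
  by apply/andP; rewrite -negb_or -mulf_eq0 -ec.
move: muc; rewrite ec muM // => muc.
have {}muc : (mu a < N)%N /\ (mu b < N)%N.
  rewrite -mu0 // -lt0n in aU; rewrite -mu0 // -lt0n in bU.
  rewrite ltnS in muc.
  split; apply: leq_trans muc; first by rewrite -addn1 leq_add2l.
  by rewrite -add1n leq_add2r.
have [a1 [a2 [h1 [s1 [ea eh es ep]]]]] :
    exists c1 c2 h' s', [/\ a = c1 * c2, h = c1%:P * h', s = c2%:P * s'
    & b%:P * p = h' * s'].
  by apply: IH; rewrite ?(proj1 muc) // -e ec polyCM mulrA.
have [b1 [b2 [h2 [s2 [eb eh2 es2 ep2]]]]] := IH b p h1 s1 (proj2 muc) b0 ep.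
exists (a1 * b1), (a2 * b2), h2, s2; split=> //.
- by rewrite ea eb mulrACA.
- by rewrite eh eh2 polyCM mulrA.
- by rewrite es es2 polyCM mulrA.
Qed.

(** The measure is the degree plus the measure of the leading coefficient. Irreducible constants
    stay prime; in positive degree, Bezout with cleared denominators applies, and [cancel_const]
    absorbs the constants. *)
Lemma ufd_poly (D : idomainType) : ufd D -> ufd {poly D}.
Proof.
move=> ufdD; have [mu [muM mu0 irrp]] := ufdD.
exists (fun p : {poly D} => (size p).-1 + mu (lead_coef p))%N; split.
- move=> a b a0 b0; rewrite lead_coefM muM ?lead_coef_eq0 // size_mul //.
  move: a0 b0; rewrite -!size_poly_gt0.
  case: (size a) => // n _; case: (size b) => // n' _ /=.
  by rewrite addnS /= addnACA.
- move=> a a0; rewrite addn_eq0 mu0 ?lead_coef_eq0 // poly_unitE.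
  move: a0; rewrite -size_poly_gt0 lead_coefE.
  by case: (size a) => [//|[|n]].
move=> p irr; have [p0 pU pirr] := irr.
have [/size_poly1P [c c0 ec]|sp] := boolP (size p == 1%N).
  by rewrite ec; apply/prime_polyC => //; apply/irrp/irreducible_polyC; rewrite -ec.
(* an irreducible polynomial of positive degree is primitive *)
have drop_const c f : c != 0 -> divides p (c%:P * f) -> divides p f.
  move=> c0 [t e].
  have [c1 [c2 [t' [p' [ec et ep ef]]]]] := cancel_const ufdD c0 e.
  case: (pirr _ _ ep) => cu.
    exists (t' * c2%:P^-1); rewrite ef -mulrA; congr (_ * _).
    by rewrite ep mulrA mulVr // mul1r.
  case/negP: sp; move: cu; rewrite poly_unitE => /andP [/eqP sp' _].
  rewrite ep size_Cmul ?sp' //.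
  by apply: contraNneq p0 => c20; rewrite ep c20 mul0r.
split=> // f g dfg.
have [uv] := Pdiv.Idomain.Bezoutp p f.
set h := gcdp p f => /eqpP [[k1 k2] /= /andP [k10 k20] eh].
have /Pdiv.Idomain.dvdpP [[c s] /= c0 es] : h %| p by apply: dvdp_gcdl.
have /Pdiv.Idomain.dvdpP [[c' s'] /= c'0 es'] : h %| f by apply: dvdp_gcdr.
rewrite -mul_polyC in es; rewrite -mul_polyC in es'.
(* Gauss's lemma replaces the gcd [h] by a true factor [h'] of [p]. Either its cofactor is a unit
   and [p] divides [f], or [h] is constant and Bezout shows that [p] divides a constant multiple of
   [g]. *)
have [c1 [c2 [t [h' [ec et eh' ep]]]]] := cancel_const ufdD c0 es.
case: (pirr _ _ ep) => [tU|h'U].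
  left; apply: (drop_const c') => //; exists (s' * c2%:P * t^-1).
  by rewrite es' eh' ep -!mulrA; do 2!congr (_ * _); rewrite mulrA mulVr // mul1r.
right.
have [c3 c30 ec3] : exists2 c3, c3 != 0 & h = c3%:P.
  move: h'U; rewrite poly_unitE => /andP [/size_poly1P [e e0 ee] _].
  exists (c2 * e); last by rewrite eh' ee polyCM.
  by rewrite mulf_neq0 //; apply: contraNneq c0 => c20; rewrite ec c20 mulr0.
apply: (drop_const (k2 * c3)); first by rewrite mulf_neq0.
rewrite polyCM -ec3 mul_polyC -eh -mul_polyC mulrDr mulrDl.
apply: dividesD; first by apply: divides_mulr; apply: divides_mull; apply: divides_mull; apply: divides_refl.
by rewrite -!mulrA; do 2!apply: divides_mull.
Qed.

Lemma ufd_field (K : fieldType) : ufd K.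
Proof.
exists (fun=> 0%N); split=> // [a a0|p [p0]]; first by rewrite unitfE a0.
by rewrite unitfE p0.
Qed.

(** * Fractions without a pole along a prime *)

Section Fractions.
Variable R : idomainType.
Implicit Types (p u v : R) (g h : {fraction R}).

Lemma fraction_repr g : g = (\n_(repr g))%:F / (\d_(repr g))%:F.
Proof.
have d0 : (\d_(repr g))%:F != 0 by rewrite tofrac_eq0 denom_ratioP.
apply: (mulIf d0); rewrite divfK // -{1}[g]reprK; move: (repr g) => r {d0}.
unlock FracField.tofrac.
rewrite -[LHS]FracField.pi_mul; apply/eqmodP; rewrite /= FracField.equivfE /FracField.mulf.
rewrite !numden_Ratio ?mulf_neq0 ?denom_ratioP ?oner_neq0 //; apply/eqP; ring.
Qed.

Lemma fractionP g : exists u v, v != 0 /\ g = u%:F / v%:F.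
Proof.
exists (\n_(repr g)), (\d_(repr g)); rewrite denom_ratioP; split=> //.
exact: fraction_repr.
Qed.

(** For prime [p], membership in the localization of [R] at [p]. *)
Definition local p g := exists u v, ~ divides p v /\ g = u%:F / v%:F.

Lemma ndivides_neq0 p v : ~ divides p v -> v%:F != 0.
Proof.
by move=> npv; rewrite tofrac_eq0; apply/eqP => v0; apply: npv; rewrite v0; apply: divides0.
Qed.

Lemma local_inv p v : ~ divides p v -> local p (v%:F)^-1.
Proof. by move=> npv; exists 1, v; rewrite tofrac1 mul1r. Qed.

Section AtPrime.
Variables (p : R) (p_prime : prime_elt p).

Lemma local_tofrac u : local p u%:F.
Proof. by exists u, 1; split; [apply: prime_ndvd1|rewrite tofrac1 divr1]. Qed.

Lemma local0 : local p 0.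
Proof. by rewrite -tofrac0; apply: local_tofrac. Qed.

Lemma localD g h : local p g -> local p h -> local p (g + h).
Proof.
move=> [u [v [pv ->]]] [u' [v' [pv' ->]]].
exists (u * v' + u' * v), (v * v'); split; first by move/(proj2 p_prime) => [].
by rewrite addf_div ?(ndivides_neq0 pv) ?(ndivides_neq0 pv') // !(tofracM, tofracD).
Qed.

Lemma localM g h : local p g -> local p h -> local p (g * h).
Proof.
move=> [u [v [pv ->]]] [u' [v' [pv' ->]]].
exists (u * u'), (v * v'); split; first by move/(proj2 p_prime) => [].
by rewrite mulf_div !tofracM.
Qed.

Lemma localN g : local p g -> local p (- g).
Proof.
by move=> pg; rewrite -mulN1r -tofrac1 -tofracN; apply: localM => //; apply: local_tofrac.
Qed.

Lemma localB g h : local p g -> local p h -> local p (g - h).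
Proof. by move=> pg ph; apply: localD => //; apply: localN. Qed.

Lemma local_sum (T : Type) (s : seq T) (P : pred T) F :
  (forall i, P i -> local p (F i)) -> local p (\sum_(i <- s | P i) F i).
Proof. by move=> H; apply: big_ind; [apply: local0|apply: localD|]. Qed.

Lemma localX g i : local p g -> local p (g ^+ i).
Proof.
move=> pg; elim: i => [|i IH]; last by rewrite exprS; apply: localM.
by rewrite expr0 -tofrac1; apply: local_tofrac.
Qed.

End AtPrime.

(** Entries of [s] may repeat, so prime powers are covered: regularity at the first entry makes it
    divide [u], and cancelling it leaves the same fraction over a shorter product. *)
Lemma local_everywhere (s : seq R) u :
  (forall p, p \in s -> p != 0 /\ prime_elt p) ->
  (forall p, p \in s -> local p (u%:F / (\prod_(q <- s) q)%:F)) ->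
  exists w, u = w * \prod_(q <- s) q.
Proof.
elim: s u => [|p s IH] u pr loc; first by exists u; rewrite big_nil mulr1.
have [p0 pp] := pr p (mem_head _ _).
have s0 : \prod_(q <- s) q != 0.
  rewrite prodf_seq_neq0; apply/allP => q qs /=.
  by have [] := pr q; rewrite // inE qs orbT.
have [u1 eu] : divides p u.
  have [a [b [pb]]] := loc p (mem_head _ _); rewrite big_cons => /eqP.
  rewrite eqr_div ?(ndivides_neq0 pb) ?tofrac_eq0 ?mulf_neq0 //.
  rewrite -!tofracM tofrac_eq => /eqP e.
  have : divides p (u * b) by rewrite e mulrCA; apply/divides_mulr/divides_refl.
  by case/(proj2 pp).
have [|q qs|w ew] := IH u1; first by move=> q qs; apply: pr; rewrite inE qs orbT.
  have := loc q; rewrite inE qs orbT => /(_ isT).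
  rewrite big_cons eu [p * _]mulrC !tofracM -mulf_div divff ?tofrac_eq0 // mulr1.
  by [].
by exists w; rewrite big_cons eu ew mulrCA mulrC mulrA.
Qed.

End Fractions.

(** * Extension of injective ring endomorphisms to fractions *)

Section FractionMap.
Variables (R : idomainType) (f : {rmorphism R -> R}).
Hypothesis f_inj : injective f.

(** The body agrees with that of [fraclift], so [sigx], [sigy] and [sigz] unfold to it; [fracmapE]
    frees it from the chosen representative. *)
Definition fracmap (g : {fraction R}) : {fraction R} :=
  let r := repr g in (f \n_r)%:F / (f \d_r)%:F.

Lemma fracmapE u v : v != 0 -> fracmap (u%:F / v%:F) = (f u)%:F / (f v)%:F.
Proof.
have f0 w : w != 0 -> (f w)%:F != 0.
  by move=> w0; rewrite tofrac_eq0 -(rmorph0 f) (inj_eq f_inj).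
move=> v0; rewrite /fracmap; move: (fraction_repr (u%:F / v%:F)).
set r := repr _ => /eqP; have r0 := denom_ratioP r.
rewrite eqr_div ?tofrac_eq0 // -!tofracM tofrac_eq => /eqP e.
apply/eqP; rewrite eqr_div ?f0 // -!tofracM tofrac_eq -!rmorphM /=.
by rewrite e.
Qed.

Lemma fracmap_tofrac u : fracmap u%:F = (f u)%:F.
Proof.
by rewrite -[u%:F]divr1 -tofrac1 fracmapE ?oner_neq0 // rmorph1 tofrac1 divr1.
Qed.

Fact fracmap_is_zmod_morphism : zmod_morphism fracmap.
Proof.
move=> g h; have [u [v [v0 ->]]] := fractionP g.
have [u' [v' [v'0 ->]]] := fractionP h.
have f0 w : w != 0 -> (f w)%:F != 0.
  by move=> w0; rewrite tofrac_eq0 -(rmorph0 f) (inj_eq f_inj).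
rewrite -mulNr addf_div ?tofrac_eq0 // !fracmapE // -mulNr addf_div ?f0 //.
rewrite -!tofracN -!tofracM -!tofracD fracmapE ?mulf_neq0 //.
by rewrite !(rmorphD, rmorphM, rmorphN).
Qed.

Fact fracmap_is_monoid_morphism : monoid_morphism fracmap.
Proof.
split; first by rewrite -tofrac1 fracmap_tofrac rmorph1.
move=> g h; have [u [v [v0 ->]]] := fractionP g.
have [u' [v' [v'0 ->]]] := fractionP h.
rewrite mulf_div -!tofracM !fracmapE ?mulf_neq0 // mulf_div.
by rewrite !rmorphM.
Qed.

End FractionMap.

(** * Actions of the lattice of integer triples, and sums over boxes *)

Lemma tripleD (a b c a' b' c' : int) :
  (a, b, c) + (a', b', c') = (a + a', b + b', c + c').
Proof. by []. Qed.

Lemma tripleN (a b c : int) : - (a, b, c) = (- a, - b, - c).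
Proof. by []. Qed.

Lemma tripleMn (a b c : int) i : (a, b, c) *+ i = (a * i%:Z, b * i%:Z, c * i%:Z).
Proof.
elim: i => [|i IH]; first by rewrite mulr0n !mulr0.
by rewrite mulrS IH tripleD intS !mulrDr !mulr1.
Qed.

Lemma tripleMz (a b c i : int) : (a, b, c) *~ i = (a * i, b * i, c * i).
Proof.
case: i => i; first by rewrite -pmulrn tripleMn.
by rewrite NegzE mulrNz -pmulrn tripleMn tripleN !mulrN.
Qed.

Section Action.
Variables (R : idomainType) (act : int * int * int -> {rmorphism R -> R}).
Hypotheses (act0 : forall p, act 0 p = p)
  (actD : forall v w p, act v (act w p) = act (v + w) p).
Implicit Types (p q : R) (g h : {fraction R}) (v w : int * int * int).

Lemma actK w : cancel (act w) (act (- w)).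
Proof. by move=> p; rewrite actD addNr act0. Qed.

Lemma act_inj w : injective (act w).
Proof. exact: can_inj (actK w). Qed.

Lemma act_fixed_eq v w p : act v p = act w p -> act (v - w) p = p.
Proof. by move=> e; rewrite addrC -actD e actK. Qed.

Lemma act_fixed_muln w p i : act w p = p -> act (w *+ i) p = p.
Proof.
by move=> wp; elim: i => [|i IH]; rewrite ?mulr0n ?act0 // mulrS -actD IH.
Qed.

Lemma act_fixed_mulz w p (i : int) : act w p = p -> act (w *~ i) p = p.
Proof.
case: i => i wp; first exact: act_fixed_muln.
by rewrite NegzE mulrNz -{1}(act_fixed_muln i.+1 wp) actK.
Qed.

Lemma divides_act w p q : divides (act w p) (act w q) <-> divides p q.
Proof.
split=> -[u e]; last by exists (act w u); rewrite e rmorphM.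
by exists (act (- w) u); apply: (@act_inj w); rewrite rmorphM /= actD subrr act0.
Qed.

Lemma act_unit w p : (act w p \is a GRing.unit) = (p \is a GRing.unit).
Proof.
apply/idP/idP => [/(rmorph_unit (act (- w)))|]; first by rewrite /= actK.
exact: rmorph_unit.
Qed.

Lemma irreducible_act w p : irreducible_elt p -> irreducible_elt (act w p).
Proof.
case=> p0 pU pirr; split; rewrite ?act_unit //.
  by rewrite -(rmorph0 (act w)) (inj_eq (@act_inj w)).
move=> a b /(congr1 (act (- w))); rewrite actK rmorphM /= => /pirr.
by rewrite !act_unit.
Qed.

Definition fract w : {fraction R} -> {fraction R} := fracmap (act w).

HB.instance Definition _ w := GRing.isZmodMorphism.Build _ _ (fract w)
  (fracmap_is_zmod_morphism (@act_inj w)).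
HB.instance Definition _ w := GRing.isMonoidMorphism.Build _ _ (fract w)
  (fracmap_is_monoid_morphism (@act_inj w)).

Lemma fract_tofrac w p : fract w p%:F = (act w p)%:F.
Proof. exact/fracmap_tofrac/act_inj. Qed.

Lemma fract_div w p q : fract w (p%:F / q%:F) = (act w p)%:F / (act w q)%:F.
Proof. by rewrite fmorph_div /= !fract_tofrac. Qed.

Lemma fractD v w g : fract v (fract w g) = fract (v + w) g.
Proof. by have [p [q [_ ->]]] := fractionP g; rewrite !fract_div !actD. Qed.

Lemma fract0 g : fract 0 g = g.
Proof. by have [p [q [_ ->]]] := fractionP g; rewrite fract_div !act0. Qed.

Lemma local_fract w p g : local (act w p) (fract w g) <-> local p g.
Proof.
have aux v q h : local q h -> local (act v q) (fract v h).
  move=> [a [b [qb ->]]]; exists (act v a), (act v b).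
  by rewrite fract_div; split=> // /divides_act.
split; last exact: aux.
by move/(aux (- w)); rewrite actK fractD addNr fract0.
Qed.

Lemma fract_coboundary0 v w : 0 = fract v 0 - 0 + (fract w 0 - 0).
Proof. by rewrite !rmorph0 !subr0 addr0. Qed.

(** The box is centred because the translates to be captured, [(n q, k q)] with [q] bounded, may
    have coordinates of either sign. *)
Definition box N g : {fraction R} :=
  \sum_(t : 'I_(N + N) * 'I_(N + N)) fract (0, t.1%:Z - N%:Z, t.2%:Z - N%:Z) g.

Lemma sum_telescope N (F : int -> {fraction R}) :
  \sum_(i < N + N) (F (i%:Z - N%:Z + 1) - F (i%:Z - N%:Z)) = F N%:Z - F (- N%:Z).
Proof.
rewrite -(big_mkord xpredT (fun i : nat => F (i%:Z - N%:Z + 1) - F (i%:Z - N%:Z))).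
have -> : F N%:Z = F ((N + N)%N%:Z - N%:Z) by congr F; rewrite PoszD addrK.
have -> : F (- N%:Z) = F (0%N%:Z - N%:Z) by rewrite sub0r.
rewrite -(telescope_sumr (fun i : nat => F (i%:Z - N%:Z)) (leq0n (N + N))).
by apply: eq_bigr => i _; congr (F _ - _); rewrite -addn1 PoszD addrAC.
Qed.

Lemma box_coboundary N g h :
  box N (fract (0, 1, 0) g - g + (fract (0, 0, 1) h - h)) =
  \sum_(j < N + N) (fract (0, N%:Z, j%:Z - N%:Z) g - fract (0, - N%:Z, j%:Z - N%:Z) g)
  + \sum_(i < N + N) (fract (0, i%:Z - N%:Z, N%:Z) h - fract (0, i%:Z - N%:Z, - N%:Z) h).
Proof.
rewrite /box.
under eq_bigr => t _ do rewrite rmorphD /= !rmorphB /= !fractD.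
rewrite big_split /=; congr (_ + _).
  rewrite -(pair_bigA _ (fun i j : 'I_(N + N) =>
    fract ((0, i%:Z - N%:Z, j%:Z - N%:Z) + (0, 1, 0)) g
    - fract (0, i%:Z - N%:Z, j%:Z - N%:Z) g)) /= exchange_big /=.
  apply: eq_bigr => j _.
  rewrite -(sum_telescope N (fun i => fract (0, i, j%:Z - N%:Z) g)).
  by apply: eq_bigr => i _; rewrite tripleD !addr0.
rewrite -(pair_bigA _ (fun i j : 'I_(N + N) =>
  fract ((0, i%:Z - N%:Z, j%:Z - N%:Z) + (0, 0, 1)) h
  - fract (0, i%:Z - N%:Z, j%:Z - N%:Z) h)) /=.
apply: eq_bigr => i _.
rewrite -(sum_telescope N (fun j => fract (0, i%:Z - N%:Z, j) h)).
by apply: eq_bigr => j _; rewrite tripleD !addr0.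
Qed.


Lemma local_act_fract v w p g :
  local (act v p) (fract w g) <-> local (act (v - w) p) g.
Proof. by have := local_fract w (act (v - w) p) g; rewrite actD subrKC. Qed.

(** Only the edges of the box survive telescoping. A pole at [d] of a translate of [g] or [h] is a
    pole of the function itself at the opposite translate of [d]; finitely many of these primes
    divide the two denominators, and edge terms of a large box are far translates. *)
Lemma box_summable_local d g h : ufd R -> irreducible_elt d ->
  (forall i j, (i, j) != (0, 0) -> ~ divides d (act (0, i, j) d)) ->
  exists B, forall N, (B <= N)%N ->
    local d (box N (fract (0, 1, 0) g - g + (fract (0, 0, 1) h - h))).
Proof.
move=> ufdR d_irr d_free.
have act_prime w : prime_elt (act w d).
  by have [mu [_ _]] := ufdR; apply; apply: irreducible_act.
have d_prime : prime_elt d by rewrite -[d]act0; apply: act_prime.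
have [u [v [v0 eg]]] := fractionP g; have [u' [v' [v'0 eh]]] := fractionP h.
pose F (t : int * int) := act (0, t.1, t.2) d.
have [| |B HB] := @finite_prime_divisors R _ (fun t : int * int => `|t.1| + `|t.2|)%N
    F (v * v') ufdR (fun t => act_prime _).
- move=> [i j] [i' j'] /= ij; rewrite /F /= => H.
  apply: (d_free (i' - i) (j' - j)).
    apply: contra ij => /eqP [e1 e2]; apply/eqP; congr (_, _); lia.
  apply/(divides_act (0, i, j)); rewrite actD tripleD.
  by rewrite addr0 !subrKC.
- exact: mulf_neq0.
exists B => N BN.
have loc i j : (N <= `|i| + `|j|)%N -> local d (fract (0, i, j) g) /\ local d (fract (0, i, j) h).
  move=> Nij; have := HB (- i, - j); rewrite /= !abszN => /(_ (leq_trans BN Nij)).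
  rewrite /F /= => nd.
  rewrite -[d]act0 !local_act_fract sub0r tripleN oppr0.
  split; [exists u, v|exists u', v']; split=> // dv; apply: nd.
    exact: divides_mulr.
  exact: divides_mull.
rewrite box_coboundary; apply: localD => //; apply: local_sum => // t _.
  by apply: localB => //; apply: (proj1 (loc _ _ _)); rewrite ?abszN /=; lia.
by apply: localB => //; apply: (proj2 (loc _ _ _)); rewrite ?abszN /=; lia.
Qed.

(** * The terms with a pole at one given shift of [d] *)

Section Residue.
Variables (d : R) (lambda m : nat) (n k : int) (t0 : nat).
Hypotheses (ufdR : ufd R) (d_irr : irreducible_elt d) (m_gt0 : (0 < m)%N)
  (d_period : act (m%:Z, - n, - k) d = d)
  (d_stab : forall w, divides d (act w d) -> exists q : int, w = (m%:Z, - n, - k) *~ q).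
Variables (a r : {fraction R}) (ls : seq {fraction R}).
Hypotheses (r_def : r = a / d%:F ^+ lambda)
  (a_local : forall v w, local (act v d) (fract w a))
  (ls_local : forall j v, local (act v d) ls`_j)
  (ls_const : forall j i l, fract (0, i, l) ls`_j = ls`_j)
  (ls_top : forall j, (t0 < j)%N -> ls`_j = 0).

Definition aligned (j : nat) := (j <= t0)%N && (m %| t0 - j)%N.
(** For aligned [j], the lattice vector with first coordinate [j] that carries [d] to its shift by
    [t0] in [x]; by [d_stab] it is the only one. *)
Definition alignment (j : nat) : int * int * int :=
  (t0%:Z, 0, 0) - (m%:Z, - n, - k) *+ ((t0 - j) %/ m).

Lemma alignmentE j : aligned j ->
  alignment j = (j%:Z, n * ((t0 - j) %/ m)%:Z, k * ((t0 - j) %/ m)%:Z).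
Proof.
case/andP => jt mj; rewrite /alignment tripleMn tripleN tripleD !mulNr !opprK !add0r.
congr (_, _, _); rewrite -PoszM mulnC divnK //; lia.
Qed.

Lemma act_alignment j : act (alignment j) d = act (t0%:Z, 0, 0) d.
Proof.
rewrite -actD; congr (act _ _); rewrite -mulNrn; apply: act_fixed_muln.
by rewrite -{1}d_period actK.
Qed.

Lemma local_fract_unaligned (j : nat) (i l : int) : (j <= t0)%N ->
  ~ (aligned j /\ (j%:Z, i, l) = alignment j) ->
  local (act (t0%:Z, 0, 0) d) (fract (j%:Z, i, l) r).
Proof.
move=> jt nal; have [mu [_ _ irr_prime]] := ufdR.
have prm := irr_prime _ (irreducible_act (t0%:Z, 0, 0) d_irr).
rewrite r_def fmorph_div /= rmorphXn /= fract_tofrac -exprVn.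
apply: localM => //; apply: localX => //; apply: local_inv => dv; apply: nal.
have [q eq] : exists q : int, (j%:Z, i, l) - (t0%:Z, 0, 0) = (m%:Z, - n, - k) *~ q.
  by apply: d_stab; apply/(divides_act (t0%:Z, 0, 0)); rewrite actD addrC subrK.
have ej : j%:Z - t0%:Z = m%:Z * q by move: eq; rewrite tripleMz => -[].
(* Since [j <= t0], the multiple of the period is nonpositive, and [- q] is the quotient occurring
   in [alignment]. *)
have q0 : q <= 0 by nia.
have eq' : (`|q| * m)%N = (t0 - j)%N by nia.
have eq2 : ((t0 - j) %/ m)%N = `|q|%N by rewrite -eq' mulnK.
have al : aligned j by rewrite /aligned jt -eq' dvdn_mull.
split=> //; rewrite alignmentE // eq2; move: eq.
rewrite tripleMz => -[_]; rewrite !subr0 => -> ->.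
by rewrite (_ : `|q|%N%:Z = - q) ?mulrN ?mulNr //; lia.
Qed.

Lemma aligned_part_local g h :
  \sum_(j < size ls) ls`_j * fract (j%:Z, 0, 0) r =
    fract (0, 1, 0) g - g + (fract (0, 0, 1) h - h) ->
  local (act (t0%:Z, 0, 0) d)
    ((\sum_(j < size ls | aligned j) ls`_j * fract (alignment j) a)
       / (act (t0%:Z, 0, 0) d)%:F ^+ lambda).
Proof.
move=> summ; have [mu [_ _ irr_prime]] := ufdR.
set D := act (t0%:Z, 0, 0) d.
have D_irr : irreducible_elt D by apply: irreducible_act.
have D_prime := irr_prime _ D_irr.
have [|B HB] := @box_summable_local D g h ufdR D_irr.
  (* A multiple of the period with zero [x] component is trivial, since [m > 0]. *)
  move=> i j ij; rewrite /D actD addrC -actD => /divides_act /d_stab [q].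
  rewrite tripleMz => -[/esym/eqP]; rewrite mulf_eq0 => /orP [/eqP|/eqP ->]; first lia.
  by rewrite !mulr0 => ei ej; rewrite ei ej eqxx in ij.
(* At least [B] for the sake of the edges, and large enough for the box to contain [(n q, k q)] for
   all [q <= t0]. *)
pose N := (B + t0 * (`|n| + `|k|) + 1)%N.
have {}HB : local D (box N (\sum_(j < size ls) ls`_j * fract (j%:Z, 0, 0) r)).
  by rewrite summ; apply: HB; rewrite /N; lia.
pose bs j := \sum_(t : 'I_(N + N) * 'I_(N + N)) fract (j%:Z, t.1%:Z - N%:Z, t.2%:Z - N%:Z) r.
have boxE : box N (\sum_(j < size ls) ls`_j * fract (j%:Z, 0, 0) r) =
    \sum_(j < size ls) ls`_j * bs j.
  rewrite /box /bs; under eq_bigr => t _ do rewrite rmorph_sum /=.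
  rewrite exchange_big /=; apply: eq_bigr => j _; rewrite big_distrr /=.
  apply: eq_bigr => t _; rewrite rmorphM /= ls_const fractD tripleD.
  by rewrite add0r !addr0.
have -> : (\sum_(j < size ls | aligned j) ls`_j * fract (alignment j) a) / D%:F ^+ lambda
    = \sum_(j < size ls | aligned j) ls`_j * fract (alignment j) r.
  rewrite big_distrl /=; apply: eq_bigr => j _; rewrite r_def fmorph_div /=.
  by rewrite rmorphXn /= fract_tofrac act_alignment -[LHS]mulrA.
(* The aligned part is the whole box sum, already regular at [D], minus terms that are all unaligned
   or zero. *)
rewrite big_mkcond /= -[X in local D X](subKr (\sum_(j < size ls) ls`_j * bs j)).
apply: localB => //; first by rewrite -boxE.
rewrite -sumrB; apply: local_sum => // j _.
have [jt|tj] := leqP j t0; last first.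
  by rewrite ls_top // !mul0r if_same subr0; apply: local0.
case: ifPn => al; last first.
  rewrite subr0; apply: localM => //; first exact: ls_local.
  rewrite /bs; apply: local_sum => // t _.
  by apply: local_fract_unaligned => // -[]; rewrite (negPf al).
rewrite -mulrBr; apply: localM => //; first exact: ls_local.
set q := ((t0 - j) %/ m)%N.
have qt : (q <= t0)%N by rewrite /q (leq_trans (leq_div _ _)) // leq_subr.
have [i0 ei0] : exists i : 'I_(N + N), i%:Z - N%:Z = n * q%:Z.
  have bnd : (`|(n * q%:Z)%R| < N)%N.
    have := leq_mul qt (leq_addr `|k| `|n|); rewrite abszM absz_nat /N; lia.
  have lt : (`|(n * q%:Z + N%:Z)%R| < N + N)%N by lia.
  by exists (Ordinal lt) => /=; lia.
have [l0 el0] : exists i : 'I_(N + N), i%:Z - N%:Z = k * q%:Z.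
  have bnd : (`|(k * q%:Z)%R| < N)%N.
    have := leq_mul qt (leq_addl `|n| `|k|); rewrite abszM absz_nat /N; lia.
  have lt : (`|(k * q%:Z + N%:Z)%R| < N + N)%N by lia.
  by exists (Ordinal lt) => /=; lia.
rewrite /bs (bigD1 (i0, l0)) //= ei0 el0 -(alignmentE al) addrAC subrr add0r.
apply: local_sum => // -[i l] il; apply: local_fract_unaligned => // -[_].
rewrite alignmentE //= -/q -ei0 -el0 => -[/addIr ei /addIr el].
case/eqP: il; congr (_, _); apply: val_inj => /=; lia.
Qed.

End Residue.

(* A pole of [a] at [c] forces, through the relation on [a], a pole at a further
   shift of [c] along the period, hence infinitely many poles. *)
Lemma local_of_relation (c : R) (m : nat) (n k : int) (t0 : nat)
    (a : {fraction R}) (ls : seq {fraction R}) :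
  let per := (m%:Z, - n, - k) in
  ufd R -> irreducible_elt c -> (0 < m)%N -> (t0 < size ls)%N ->
  (forall q : int, q != 0 -> ~ divides c (act (per *~ q) c)) ->
  (forall w j, local (act w c) ls`_j) ->
  (forall w, local (act w c) (ls`_t0)^-1) -> ls`_t0 != 0 ->
  \sum_(j < size ls | aligned m t0 j) ls`_j * fract (alignment m n k t0 j) a = 0 ->
  local c a.
Proof.
move=> per ufdR c_irr m0 t0s c_free ls_loc lsV_loc ls0 rel.
have prm w : prime_elt (act w c).
  by have [mu [_ _]] := ufdR; apply; apply: irreducible_act.
(* After transport by [t0] in [x], the relation expresses its top term through the other aligned
   [j], which involve [a] only at [per *+ (e + q)] with [q = (t0 - j) / m > 0]. *)
have step (e : nat) : (forall q : nat, (0 < q)%N -> local (act (per *+ (e + q)) c) a) ->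
    local (act (per *+ e) c) a.
  move=> loc; apply/(local_fract (t0%:Z, 0, 0)); rewrite actD.
  set w := _ + _.
  have al0 : aligned m t0 (Ordinal t0s) by rewrite /aligned /= leqnn subnn dvdn0.
  have ali0 : alignment m n k t0 t0 = (t0%:Z, 0, 0).
    by rewrite /alignment subnn div0n mulr0n subr0.
  move: rel; rewrite (bigD1 (Ordinal t0s)) //= ali0 => /eqP.
  rewrite addr_eq0 => /eqP /(canRL (mulKf ls0)) ->.
  apply: localM => //; apply: localN => //; apply: local_sum => // j /andP [al jt].
  apply: localM => //; apply/local_act_fract.
  have -> : w - alignment m n k t0 j = per *+ (e + (t0 - j) %/ m)%N.
    by rewrite /w /alignment mulrnDr opprB [LHS]addrC addrA subrK addrC.
  case/andP: al => jt0 mj; apply: loc; rewrite divn_gt0 // dvdn_leq // subn_gt0.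
  by rewrite ltn_neqAle jt0 andbT -(inj_eq val_inj) in jt *.
(* Otherwise a pole at [c] yields poles at arbitrarily high multiples of the period, and all these
   shifts of [c] divide the one denominator [v]. *)
apply: NNPP => nloc; have [u [v [v0 ea]]] := fractionP a.
have far N : exists e, (N <= e)%N /\ ~ local (act (per *+ e) c) a.
  elim: N => [|N [e [Ne ne]]]; first by exists 0; rewrite mulr0n act0.
  apply: NNPP => H; apply: ne; apply: step => q q0; apply: NNPP => nl; apply: H.
  by exists (e + q)%N; split=> //; rewrite -addn1 leq_add.
have [|//|B HB] := @finite_prime_divisors R _ id (fun e : nat => act (per *+ e) c) v ufdR
    (fun e => prm _) _ _.
  move=> e e' ee' H; apply: (c_free (e'%:Z - e%:Z)); first by rewrite subr_eq0 eq_sym.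
  apply/(divides_act (per *+ e)); rewrite actD.
  suff -> : per *+ e + per *~ (e'%:Z - e%:Z) = per *+ e' by [].
  by rewrite mulrzBr -!pmulrn subrKC.
by have [e [Be ne]] := far B; apply: ne; exists u, v; split=> //; apply: HB.
Qed.

End Action.

(** * Degree bounds, and properness in the outer variable *)

Lemma ndivides_small (D : idomainType) (p q : {poly D}) :
  q != 0 -> (size q < size p)%N -> ~ divides p q.
Proof.
move=> q0 sqp [u e]; move: q0 sqp; rewrite e mulf_eq0 negb_or => /andP [u0 p0].
rewrite size_mul //; move: u0; rewrite -size_poly_gt0.
by case: (size u) => // i _; rewrite addSn /= ltnNge leq_addl.
Qed.

Lemma divides_polyC (D : idomainType) (p q : D) :
  divides p%:P q%:P -> divides p q.
Proof.
by case=> u /(congr1 (horner^~ 0)); rewrite !hornerE => e; exists u.[0].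
Qed.

Lemma pchar0_poly (D : nzRingType) : [pchar D] =i pred0 -> [pchar {poly D}] =i pred0.
Proof.
by move=> D0 p; rewrite -(D0 p) !inE -polyC_natr polyC_eq0.
Qed.


Lemma divides_of_local (R : idomainType) (d p q : R) lambda :
  prime_elt d -> d != 0 -> (0 < lambda)%N -> q != 0 ->
  local d (p%:F / q%:F / d%:F ^+ lambda) -> divides d p.
Proof.
move=> pd d0 l0 q0 [u [v [dv]]]; have v0 := ndivides_neq0 dv.
rewrite -mulrA -invfM -tofracXn -tofracM => /eqP.
rewrite eqr_div // ?tofrac_eq0 ?mulf_neq0 ?expf_neq0 //.
rewrite -!tofracM tofrac_eq => /eqP e.
have : divides d (p * v).
  rewrite e -(prednK l0) exprS; do 2!apply: divides_mull.
  exact/divides_mulr/divides_refl.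
by case/(proj2 pd).
Qed.

(** A zero denominator is permitted by [in_Kx], and inverting a zero coefficient produces one; as
    the inverse of 0 is 0, such a fraction becomes [0 / 1]. *)
Lemma fraction_regular (T R : idomainType) (f : {rmorphism T -> R}) p q :
  exists p' q', q' != 0 /\ (f p)%:F / (f q)%:F = (f p')%:F / (f q')%:F.
Proof.
have [->|q0] := eqVneq q 0; last by exists p, q.
by exists 0, 1; rewrite oner_neq0 !rmorph0 ?tofrac0 invr0 mulr0 mul0r.
Qed.

Lemma fraction1 (T R : idomainType) (f : {rmorphism T -> R}) :
  1 = (f 1)%:F / (f 1)%:F.
Proof. by rewrite rmorph1 tofrac1 divr1. Qed.

Section ProperFractions.
Variable E : idomainType.
Implicit Types (d p : {poly E}) (g l : {fraction {poly E}}).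

(** Keeping the denominator free of the outer variable makes the class stable under sums, shifts and
    coefficients from [K(x)], so with [s = size d] it contains the whole aligned sum. *)
Definition proper_frac (s : nat) g := exists p (q : E),
  [/\ q != 0, (size p < s)%N & g = p%:F / (q%:P)%:F].

Lemma proper_frac0 s : (0 < s)%N -> proper_frac s 0.
Proof.
move=> s0; exists 0, 1; rewrite oner_neq0 size_poly0; split=> //.
by rewrite tofrac0 mul0r.
Qed.

Lemma proper_fracD s g l : proper_frac s g -> proper_frac s l -> proper_frac s (g + l).
Proof.
move=> [p [q [q0 sp ->]]] [p' [q' [q'0 sp' ->]]].
exists (p * q'%:P + p' * q%:P), (q * q'); rewrite mulf_neq0 //; split=> //.
  rewrite (leq_ltn_trans (size_polyD _ _)) // gtn_max.
  by rewrite ![_ * _%:P]mulrC !size_Cmul // sp.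
by rewrite addf_div ?tofrac_eq0 ?polyC_eq0 // polyCM !(tofracD, tofracM).
Qed.

Lemma proper_frac_scale s (u v : E) g : v != 0 -> proper_frac s g ->
  proper_frac s ((u%:P)%:F / (v%:P)%:F * g).
Proof.
move=> v0 [p [q [q0 sp ->]]].
exists (u%:P * p), (v * q); rewrite mulf_neq0 //; split=> //.
  by rewrite mul_polyC (leq_ltn_trans _ sp) // size_scale_leq.
by rewrite mulf_div polyCM !tofracM.
Qed.

Lemma proper_frac_map s (f : {rmorphism {poly E} -> {poly E}}) (f0 : E -> E) g :
  injective f -> (forall p, size (f p) = size p) -> (forall q, f q%:P = (f0 q)%:P) ->
  proper_frac s g -> proper_frac s (fracmap f g).
Proof.
move=> f_inj sf fC [p [q [q0 sp ->]]]; exists (f p), (f0 q).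
rewrite sf fracmapE ?polyC_eq0 // fC; split=> //.
by rewrite -polyC_eq0 -fC -(rmorph0 f) (inj_eq f_inj) polyC_eq0.
Qed.

Lemma proper_frac_local s d g : (1 < size d)%N -> proper_frac s g -> local d g.
Proof.
move=> sd [p [q [q0 _ ->]]]; exists p, q%:P; split=> //.
apply: ndivides_small; rewrite ?polyC_eq0 //.
by rewrite (leq_ltn_trans (size_polyC_leq1 _)).
Qed.

(** Regularity makes [d] divide a numerator of smaller degree. This turns the absence of a pole into
    an exact identity. *)
Lemma proper_frac_eq0 d lambda g : prime_elt d -> d != 0 -> (0 < lambda)%N ->
  proper_frac (size d) g -> local d (g / d%:F ^+ lambda) -> g = 0.
Proof.
move=> pd d0 l0 [p [q [q0 sp ->]]] loc.
suff -> : p = 0 by rewrite tofrac0 mul0r.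
apply/eqP; apply: contraT => p0; exfalso; apply: (ndivides_small p0 sp).
by apply: divides_of_local pd d0 l0 _ loc; rewrite polyC_eq0.
Qed.

Lemma proper_frac_sum (I : finType) (mi : I -> nat) b (c : I -> E) s :
  (0 < s)%N -> (forall i, c i != 0) ->
  (forall i (l : nat), (1 <= l <= mi i)%N -> (size (b i l : {poly E}) < s)%N) ->
  proper_frac s (\sum_i \sum_(1 <= l < (mi i).+1) (b i l)%:F / ((c i)%:P)%:F ^+ l).
Proof.
move=> s0 c0 sb; have P0 := proper_frac0 s0; have PD := @proper_fracD s.
apply: big_ind => // i _; rewrite big_nat; apply: big_ind => // l /sb sbl.
exists (b i l), (c i ^+ l); rewrite expf_neq0 //; split=> //.
by rewrite polyC_exp tofracXn.
Qed.

End ProperFractions.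

(** * Properness in the inner variable *)

Section CoefProper.
Variable F : idomainType.
Implicit Types (c : {poly F}) (p : {poly {poly F}}) (g l : {fraction {poly {poly F}}}).

(* Proper in the inner variable, with all poles along elements of C. *)
Definition coef_proper (C : {poly F} -> Prop) g := exists (s : seq {poly F}) p,
  [/\ forall c, c \in s -> C c,
      forall i, (size (p`_i)%R < size (\prod_(c <- s) c)%R)%N
    & g = p%:F / ((\prod_(c <- s) c)%:P)%:F].

Lemma coef_proper0 C : coef_proper C 0.
Proof.
exists [::], 0; split=> //; last by rewrite tofrac0 mul0r.
by move=> i; rewrite big_nil size_poly1 coef0 size_poly0.
Qed.

Lemma coef_properD C g l : (forall c, C c -> c != 0) ->
  coef_proper C g -> coef_proper C l -> coef_proper C (g + l).
Proof.
move=> C0 [s [p [sC sp ->]]] [s' [p' [s'C sp' ->]]].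
have neq0 (t : seq {poly F}) : (forall c, c \in t -> C c) -> \prod_(c <- t) c != 0.
  move=> tC; rewrite prodf_seq_neq0; apply/allP => c ct /=.
  exact/C0/tC.
have := neq0 _ sC; have := neq0 _ s'C.
set P := \prod_(c <- s) c in sp *; set P' := \prod_(c <- s') c in sp' * => P'0 P0.
exists (s ++ s'), (p * P'%:P + p' * P%:P); rewrite big_cat /= -/P -/P'; split.
- by move=> c; rewrite mem_cat => /orP [/sC|/s'C].
- have aux (u a b : {poly F}) : a != 0 -> b != 0 -> (size u < size a)%N ->
      (size (u * b)%R < size (a * b)%R)%N.
    move=> a0 b0 ua; rewrite (size_mul a0 b0); have [->|u0] := eqVneq u 0.
      rewrite mul0r size_poly0; move: a0 b0; rewrite -!size_poly_gt0; lia.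
    rewrite size_mul //; move: u0 b0; rewrite -!size_poly_gt0; lia.
  move=> i; rewrite coefD !coefMC.
  rewrite (leq_ltn_trans (size_polyD _ _)) // gtn_max; apply/andP; split.
    exact: aux.
  by rewrite [P * P']mulrC; apply: aux.
by rewrite addf_div ?tofrac_eq0 ?polyC_eq0 // polyCM !(tofracD, tofracM).
Qed.

Lemma coef_proper_term (C : {poly F} -> Prop) c p i : C c -> (0 < i)%N ->
  (forall j, (size (p`_j)%R < size c)%N) -> coef_proper C (p%:F / (c%:P)%:F ^+ i).
Proof.
move=> Cc i0 pc; have e : \prod_(x <- nseq i c) x = c ^+ i.
  by elim: (i) => [|k IH] /=; rewrite ?big_nil ?expr0 // big_cons IH exprS.
exists (nseq i c), p; rewrite e; split.
- by move=> c' /nseqP [->].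
- move=> j; apply: leq_trans (pc j) _.
  have c0 : c != 0 by rewrite -size_poly_gt0; apply: leq_trans (pc j).
  case: i i0 {e} => // i _; rewrite exprS; have [->|i0] := posnP i; first by rewrite expr0 mulr1.
  rewrite size_mul ?expf_neq0 //.
  have : (0 < size (c ^+ i)%R)%N by rewrite size_poly_gt0 expf_neq0.
  by case: (size _) => // k _; rewrite addnS leq_addr.
by rewrite -tofracXn -polyC_exp.
Qed.

(** The denominator, a product of primes with repetition, must divide the numerator and hence each
    of its coefficients, whose degrees are too small. *)
Lemma coef_proper_eq0 (C : {poly F} -> Prop) g :
  (forall c, C c -> c != 0 /\ prime_elt c) -> coef_proper C g ->
  (forall c, C c -> local c%:P g) -> g = 0.
Proof.
move=> Cprime [s [p [sC sp eg]]] loc.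
have eprod : (\prod_(c <- s) c)%:P = \prod_(c <- [seq c%:P | c <- s]) c :> {poly {poly F}}.
  by rewrite big_map rmorph_prod.
have [q|q|w ew] := @local_everywhere _ [seq c%:P | c <- s] p.
- case/mapP => c /sC /Cprime [c0 cp] ->; rewrite polyC_eq0; split=> //.
  exact: prime_polyC.
- by case/mapP => c /sC /loc; rewrite -eprod -eg => + ->.
suff p0 : p = 0 by rewrite eg p0 tofrac0 mul0r.
apply/polyP => i; rewrite coef0; apply/eqP.
apply: contraT => pi0; exfalso.
apply: (ndivides_small pi0 (sp i)); exists w`_i.
by rewrite ew -eprod coefMC.
Qed.

Lemma coef_proper_sum (I : finType) (mi : I -> nat) b (c : I -> {poly F})
    (C : {poly F} -> Prop) :
  (forall x, C x -> x != 0) -> (forall i, (1 < size (c i))%N -> C (c i)) ->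
  (forall i (l j : nat), (1 <= l <= mi i)%N ->
    (size ((b i l : {poly {poly F}})`_j)%R < size (c i))%N) ->
  coef_proper C (\sum_i \sum_(1 <= l < (mi i).+1) (b i l)%:F / ((c i)%:P)%:F ^+ l).
Proof.
move=> C0 Cc sb; have P0 := coef_proper0 C; have PD := coef_properD C0.
apply: big_ind => // i _; rewrite big_nat; apply: big_ind => // l li.
have [ci|ci] := ltnP 1 (size (c i)).
  apply: coef_proper_term; [exact: Cc|by case/andP: li|] => j; exact: sb.
(* When [c i] is constant in the inner variable, the degree bound leaves only a zero numerator. *)
suff -> : b i l = 0 by rewrite tofrac0 mul0r.
apply/polyP => j; rewrite coef0; apply/eqP; rewrite -size_poly_leq0 -ltnS.
exact: leq_trans (sb i l j li) ci.
Qed.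

End CoefProper.

(** * The vanishing argument for an abstract lattice action *)

Section Core.
Variable F : idomainType.
Let R : idomainType := {poly {poly F}}.
Variables (act : int * int * int -> {rmorphism R -> R})
  (act2 : int * int * int -> {poly F} -> {poly F}).
Hypotheses (act0 : forall p, act 0 p = p)
  (actD : forall v w p, act v (act w p) = act (v + w) p)
  (size_act : forall w (p : {poly {poly F}}), size (act w p : {poly {poly F}}) = size p)
  (act_polyC : forall w (q : {poly F}), act w q%:P = (act2 w q)%:P)
  (size_act2 : forall w q, size (act2 w q) = size q)
  (act_const : forall i j (u : F), act (0, i, j) u%:P%:P = u%:P%:P)
  (ufdR : ufd R).

Definition const_fraction (l : {fraction R}) := exists u v : F,
  v != 0 /\ l = (u%:P%:P)%:F / (v%:P%:P)%:F.

Lemma const_fractionV l : const_fraction l -> const_fraction l^-1.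
Proof.
move=> [u [v [v0 ->]]]; rewrite invf_div.
have [p [q [q0 ->]]] := @fraction_regular F R (polyC \o polyC) v u.
by exists p, q.
Qed.

Lemma local_const_fraction w (c : {poly F}) l : (1 < size c)%N ->
  const_fraction l -> local (act w c%:P) l.
Proof.
move=> sc [u [v [v0 ->]]]; exists u%:P%:P, v%:P%:P; split; last reflexivity.
rewrite act_polyC => /divides_polyC; apply: ndivides_small.
  by rewrite polyC_eq0.
by rewrite size_act2 (leq_ltn_trans (size_polyC_leq1 _)).
Qed.

Variables (d : R) (lambda m : nat) (n k : int).
Let per := (m%:Z, - n, - k).
Hypotheses (d_irr : irreducible_elt d) (d_size : (1 < size (d : {poly {poly F}}))%N)
  (lambda_gt0 : (0 < lambda)%N) (m_gt0 : (0 < m)%N) (d_period : act per d = d)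
  (d_stab : forall w, divides d (act w d) -> exists q : int, w = per *~ q).
Variable C : {poly F} -> Prop.
Hypotheses (C_prime : forall c, C c -> c != 0 /\ prime_elt c)
  (C_size : forall c, C c -> (1 < size c)%N)
  (C_free : forall c (q : int), C c -> q != 0 -> ~ divides c%:P (act (per *~ q) c%:P)).
Variables (a : {fraction R}) (ls : seq {fraction R}) (g h : {fraction R}).
Hypotheses (a_proper : proper_frac (size (d : {poly {poly F}})) a)
  (a_coef_proper : coef_proper C a)
  (ls_const : forall l, l \in ls -> const_fraction l)
  (ls_neq0 : has (fun l => l != 0) ls)
  (summ : \sum_(j < size ls) ls`_j * fract act (j%:Z, 0, 0) (a / d%:F ^+ lambda) =
    fract act (0, 1, 0) g - g + (fract act (0, 0, 1) h - h)).

Lemma no_telescoper : a = 0.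
Proof.
have constE j : const_fraction ls`_j.
  have [js|sj] := ltnP j (size ls); first exact/ls_const/mem_nth.
  by rewrite nth_default //; exists 0, 1; rewrite oner_neq0 !polyC0 tofrac0 mul0r.
have [t0 [t0s lt0 ltop]] : exists t0, [/\ (t0 < size ls)%N, ls`_t0 != 0
    & forall j, (t0 < j)%N -> ls`_j = 0].
  have ex : exists i, (i < size ls)%N && (ls`_i != 0).
    by case/(has_nthP 0): ls_neq0 => i is0 li; exists i; rewrite is0.
  have bd i : (i < size ls)%N && (ls`_i != 0) -> (i <= size ls)%N by case/andP => /ltnW.
  case: (ex_maxnP ex bd) => t0 /andP [t0s l0] tmax; exists t0; split=> // j tj.
  apply/eqP; apply: contraT => lj; have [js|sj] := ltnP j (size ls).
    by move: (tmax j); rewrite js lj => /(_ isT); rewrite leqNgt tj.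
  by rewrite nth_default ?eqxx in lj.
have proper_fract w s l : proper_frac s l -> proper_frac s (fract act w l).
  exact: (proper_frac_map (act_inj act0 actD (w := w)) (size_act w) (act_polyC w)).
have proper_loc s w l : proper_frac s l -> local (act w d) l.
  by apply: proper_frac_local; rewrite size_act.
have const_proper l : const_fraction l -> proper_frac 2 l.
  move=> [u [v [v0 ->]]]; exists u%:P%:P, v%:P; rewrite polyC_eq0; split=> //.
  exact: leq_ltn_trans (size_polyC_leq1 _) _.
pose D := act (t0%:Z, 0, 0) d.
have irr_prime (p : R) : irreducible_elt p -> prime_elt p.
  by have [mu [_ _]] := ufdR; apply.
have D_irr : irreducible_elt D by apply: irreducible_act.
(* This sum is proper relative to [D], so its regularity over [D ^+ lambda] forces it to vanish. *)
have rel : \sum_(j < size ls | aligned m t0 j)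
    ls`_j * fract act (alignment m n k t0 j) a = 0.
  apply: (@proper_frac_eq0 _ D lambda); rewrite ?size_act //.
  - exact: irr_prime.
  - by case: D_irr.
  - apply: big_ind; first by apply: proper_frac0; apply: leq_ltn_trans d_size.
      by move=> x y; apply: proper_fracD.
    move=> j _; have [u [v [v0 ->]]] := constE j.
    by apply: proper_frac_scale; [rewrite polyC_eq0|apply: proper_fract].
  apply: (aligned_part_local act0 actD ufdR d_irr m_gt0 d_period d_stab
    erefl _ _ _ ltop summ).
  - by move=> v w; apply: proper_loc; apply: proper_fract a_proper.
  - by move=> j v; apply: proper_loc (const_proper _ (constE j)).
  - move=> j i l; have [u [v [v0 ->]]] := constE j.
    by rewrite fract_div // !act_const.
apply: (coef_proper_eq0 C_prime a_coef_proper) => c Cc.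
have [c0 pc] := C_prime Cc.
apply: (local_of_relation act0 actD (m := m) (n := n) (k := k) ufdR _ m_gt0 t0s _ _ _ lt0 rel).
- by apply: prime_irreducible; [rewrite polyC_eq0|apply: prime_polyC].
- by move=> q q0; apply: C_free.
- by move=> w j; apply: local_const_fraction; [apply: C_size|].
- by move=> w; apply: local_const_fraction; [apply: C_size|apply: const_fractionV].
Qed.

End Core.

(** Units of a polynomial ring are constant, so a leading coefficient that detects the unit 1 over
    [D] still does so over [{poly D}]; three uses lead from [K] to [K[x,y,z]]. *)
Lemma unit_fixing_lead (D : idomainType) (T : Type) (L : D -> T) :
  (forall u p, u \is a GRing.unit -> p != 0 -> L (u * p) = L p -> u = 1) ->
  forall u p : {poly D}, u \is a GRing.unit -> p != 0 ->
  L (lead_coef (u * p)) = L (lead_coef p) -> u = 1.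
Proof.
move=> fixL u p; rewrite poly_unitE => /andP [/size_poly1P [v _ ->]].
rewrite coefC /= => vU p0; rewrite lead_coefM lead_coefC => /fixL -> //.
by rewrite lead_coef_eq0.
Qed.

(** * Translations of one variable *)

Section Shift.
Variable T : idomainType.
Implicit Types (a : T) (p : {poly T}).

Lemma comp_shiftD a b p :
  (p \Po ('X + b%:P)) \Po ('X + a%:P) = p \Po ('X + (a + b)%:P).
Proof.
by rewrite -comp_polyA comp_polyD comp_polyX comp_polyC polyCD addrA.
Qed.

Lemma comp_shift0 p : p \Po ('X + 0%:P) = p.
Proof. by rewrite addr0 comp_polyXr. Qed.

Lemma size_comp_shift a p : size (p \Po ('X + a%:P)) = size p.
Proof. by rewrite size_comp_poly2 // size_XaddC. Qed.

Lemma lead_coef_comp_shift a p : lead_coef (p \Po ('X + a%:P)) = lead_coef p.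
Proof.
rewrite lead_coef_comp ?size_XaddC // lead_coefXaddC.
by rewrite expr1n mulr1.
Qed.

Lemma comp_shift_inj a : injective (comp_poly ('X + a%:P)).
Proof.
apply: (can_inj (g := comp_poly ('X + (- a)%:P))) => p.
by rewrite comp_shiftD addNr comp_shift0.
Qed.

(** The value [p.[0]] is taken at all multiples of [a], which are pairwise distinct in
    characteristic 0: too many roots for [p - p.[0]%:P], unless it is 0. *)
Lemma comp_shift_fixed a p :
  [pchar T] =i pred0 -> a != 0 -> p \Po ('X + a%:P) = p -> (size p <= 1)%N.
Proof.
move=> char0 a0 e.
have ev i : p.[a *+ i] = p.[0].
  elim: i => [|i <-]; first by rewrite mulr0n.
  by rewrite -{2}e horner_comp !hornerE mulrSr.
have inj : injective (fun i => a *+ i).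
  suff aux i j : (i <= j)%N -> a *+ i = a *+ j -> i = j.
    move=> i j; case/orP: (leq_total i j) => ij eij; first exact: aux.
    by apply/esym/aux.
  move=> ij /eqP; rewrite eq_sym -subr_eq0 -mulrnBr // -mulr_natr mulf_eq0.
  rewrite (negPf a0) /= (proj1 (pcharf0P T) char0) subn_eq0 => ji.
  by apply/eqP; rewrite eqn_leq ij.
rewrite leqNgt; apply/negP => sp.
have q0 : p - p.[0]%:P != 0.
  apply: contraTneq sp => /eqP; rewrite subr_eq0 => /eqP ->.
  by rewrite -leqNgt size_polyC leq_b1.
pose rs := [seq a *+ i | i <- iota 0 (size (p - p.[0]%:P))].
have := @max_poly_roots _ _ rs q0.
rewrite size_map size_iota ltnn map_inj_uniq // iota_uniq => H.
suff : false by []; apply: H => //.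
by apply/allP => x /mapP [i _ ->]; rewrite /root !hornerE ev subrr.
Qed.

End Shift.

(** * Shift automorphisms of [K[x,y,z]] *)

Section ShiftsOfPolynomials.
Variable K : fieldType.
Implicit Types (a : K) (p q : Pxyz K).

HB.instance Definition _ a := GRing.RMorphism.copy (@shx K a)
  (map_poly (map_poly (comp_poly ('X + a%:P)))).
HB.instance Definition _ a := GRing.RMorphism.copy (@shy K a)
  (map_poly (comp_poly ('X + a%:P%:P))).
HB.instance Definition _ a := GRing.RMorphism.copy (@shz K a)
  (comp_poly ('X + a%:P%:P%:P)).

Lemma shxD a b p : shx a (shx b p) = shx (a + b) p.
Proof.
rewrite /shx -map_poly_comp; apply: eq_map_poly => q /=.
rewrite -map_poly_comp; apply: eq_map_poly => r /=; exact: comp_shiftD.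
Qed.

Lemma shyD a b p : shy a (shy b p) = shy (a + b) p.
Proof.
by rewrite /shy -map_poly_comp; apply: eq_map_poly => q /=; rewrite polyCD comp_shiftD.
Qed.

Lemma shzD a b p : shz a (shz b p) = shz (a + b) p.
Proof. by rewrite /shz comp_shiftD -!polyCD. Qed.

Lemma shxy a b p : shx a (shy b p) = shy b (shx a p).
Proof.
rewrite /shx /shy -!map_poly_comp; apply: eq_map_poly => q /=.
by rewrite map_comp_poly rmorphD /= map_polyX map_polyC /= comp_polyC.
Qed.

Lemma shxz a c p : shx a (shz c p) = shz c (shx a p).
Proof.
by rewrite /shx /shz map_comp_poly rmorphD /= map_polyX !map_polyC /= map_polyC /= comp_polyC.
Qed.

Lemma shyz b c p : shy b (shz c p) = shz c (shy b p).
Proof.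
by rewrite /shy /shz map_comp_poly rmorphD /= map_polyX !map_polyC /= comp_polyC.
Qed.

Lemma shx0 p : shx 0 p = p.
Proof.
rewrite /shx map_poly_id // => q _; rewrite map_poly_id // => r _.
exact: comp_shift0.
Qed.

Lemma shy0 p : shy 0 p = p.
Proof. by rewrite /shy map_poly_id // => q _; apply: comp_shift0. Qed.

Lemma shz0 p : shz 0 p = p.
Proof. exact: comp_shift0. Qed.

Definition sh (w : int * int * int) p : Pxyz K :=
  shx w.1.1%:~R (shy w.1.2%:~R (shz w.2%:~R p)).
HB.instance Definition _ w := GRing.RMorphism.copy (@sh w)
  (shx (w.1.1%:~R) \o (shy (w.1.2%:~R) \o shz (w.2%:~R))).

Lemma shD v w p : sh v (sh w p) = sh (v + w) p.
Proof.
rewrite /sh /= !intrD -shxD -shyD -shzD.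
by rewrite -[shz _ (shx _ _)]shxz -[shz _ (shy _ _)]shyz -[shy _ (shx _ _)]shxy.
Qed.

Lemma sh0 p : sh 0 p = p.
Proof. by rewrite /sh /= shz0 shy0 shx0. Qed.

Lemma size_sh w p : size (sh w p) = size p.
Proof.
rewrite /sh /shx size_map_inj_poly ?rmorph0 //; last first.
  by apply: map_inj_poly; [apply: comp_shift_inj|rewrite comp_poly0].
rewrite /shy size_map_inj_poly ?comp_poly0 //; last exact: comp_shift_inj.
exact: size_comp_shift.
Qed.

Definition sh2 (w : int * int * int) (q : Pxy K) : Pxy K :=
  map_poly (comp_poly ('X + (w.1.1%:~R)%:P)) (q \Po ('X + (w.1.2%:~R)%:P%:P)).

Lemma sh_polyC w (q : Pxy K) : sh w q%:P = (sh2 w q)%:P.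
Proof.
by rewrite /sh /shz comp_polyC /shy map_polyC /shx map_polyC.
Qed.

Lemma size_sh2 w (q : Pxy K) : size (sh2 w q) = size q.
Proof.
rewrite /sh2 size_map_inj_poly ?comp_poly0 //; last exact: comp_shift_inj.
exact: size_comp_shift.
Qed.

Lemma lead_coef3_sh w p :
  lead_coef (lead_coef (lead_coef (sh w p))) =
  lead_coef (lead_coef (lead_coef p)).
Proof.
have i1 := @comp_shift_inj {poly K}; have i2 := @comp_shift_inj K.
rewrite /sh /shx lead_coef_map_inj ?rmorph0 //; last first.
  by apply: map_inj_poly; rewrite ?comp_poly0.
rewrite lead_coef_map_inj ?comp_poly0 // lead_coef_comp_shift.
rewrite /shy lead_coef_map_inj ?comp_poly0 // lead_coef_comp_shift.
by rewrite lead_coef_comp_shift.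
Qed.

(** The quotient is a unit, and equal iterated leading coefficients leave only 1. By [lead_coef3_sh]
    this applies to any two shifts of one irreducible polynomial. *)
Lemma associate_irreducible_eq p q : irreducible_elt p -> irreducible_elt q ->
  lead_coef (lead_coef (lead_coef p)) = lead_coef (lead_coef (lead_coef q)) ->
  divides p q -> p = q.
Proof.
move=> [p0 pU _] [_ _ qirr] e [u eu]; case: (qirr _ _ eu) => [uU|/(negP pU)//].
suff u1 : u = 1 by rewrite eu u1 mul1r.
move: uU p0 (esym e); rewrite eu; move: u p {pU e eu}.
apply: (@unit_fixing_lead (Pxy K) K (fun v => lead_coef (lead_coef v))).
apply: (@unit_fixing_lead {poly K} K (fun v => lead_coef v)).
apply: (@unit_fixing_lead K K id).
move=> u p _ p0 /eqP; rewrite -subr_eq0 -{2}[p]mul1r -mulrBl mulf_eq0 (negPf p0).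
by rewrite orbF subr_eq0 => /eqP.
Qed.

Lemma ufd_Pxy : ufd (Pxy K).
Proof. by do 2!apply: ufd_poly; apply: ufd_field. Qed.

Lemma ufd_Pxyz : ufd (Pxyz K).
Proof. exact/ufd_poly/ufd_Pxy. Qed.

Lemma irreducible_Pxy (q : Pxy K) :
  irreducible_elt q -> irreducible_elt (q%:P : Pxyz K).
Proof.
move=> irr; have [q0 _ _] := irr; apply: prime_irreducible.
  by rewrite polyC_eq0.
by apply: prime_polyC => //; have [mu [_ _]] := ufd_Pxy; apply.
Qed.

End ShiftsOfPolynomials.

(** * Shifts of rational functions, and stabilizers *)

Section RationalFunctions.
Variable K : fieldType.
Implicit Types (p q : Pxyz K) (g l : Fxyz K) (v w : int * int * int).

Lemma sizey_ltP p n :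
  (sizey p < n)%N <-> (0 < n)%N /\ forall i, (size (p`_i)%R < n)%N.
Proof.
case: n => [|n]; first by split=> // -[].
rewrite /sizey ltnS; split=> [/bigmax_leqP H|[_ H]].
  split=> // i; rewrite ltnS; have [ip|pi] := ltnP i (size p).
    exact: (H (Ordinal ip)).
  by rewrite nth_default // size_poly0.
by apply/bigmax_leqP => i _; rewrite -ltnS.
Qed.

Definition shift w : {rmorphism Pxyz K -> Pxyz K} := @sh K w.

Notation fshift := (fract shift).

Lemma shift0 p : shift 0 p = p. Proof. exact: sh0. Qed.

Lemma shiftD v w p : shift v (shift w p) = shift (v + w) p.
Proof. exact: shD. Qed.

Lemma shift_x (i : int) p : shift (i, 0, 0) p = shx i%:~R p.
Proof. by rewrite /shift /= /sh /= shz0 shy0. Qed.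

Lemma shift_yz (i j : int) p : shift (0, i, j) p = shy i%:~R (shz j%:~R p).
Proof. by rewrite /shift /= /sh /= shx0. Qed.

Lemma sigxE g : sigx g = fshift (1, 0, 0) g.
Proof. by rewrite /fract /fracmap !shift_x. Qed.

Lemma sigyE g : sigy g = fshift (0, 1, 0) g.
Proof. by rewrite /fract /fracmap !shift_yz !shz0. Qed.

Lemma sigzE g : sigz g = fshift (0, 0, 1) g.
Proof. by rewrite /fract /fracmap !shift_yz !shy0. Qed.

Lemma iter_sigx i g : iter i (@sigx K) g = fshift (i%:Z, 0, 0) g.
Proof.
elim: i => [|i IH] /=; first by rewrite (fract0 shift0 shiftD).
by rewrite IH sigxE (fractD shift0 shiftD) tripleD !addr0 -intS.
Qed.

Lemma shift_polyC w (q : Pxy K) : shift w q%:P = (sh2 w q)%:P.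
Proof. exact: sh_polyC. Qed.

Lemma shift_polyCC w (q : {poly K}) :
  shift w q%:P%:P = (q \Po ('X + (w.1.1%:~R)%:P))%:P%:P.
Proof. by rewrite shift_polyC /sh2 comp_polyC map_polyC. Qed.


Lemma in_Kx_const_fraction l : in_Kx l -> const_fraction l.
Proof.
move=> [u [v ->]].
have [p [q [q0 ->]]] := @fraction_regular {poly K} (Pxyz K) (polyC \o polyC) u v.
by exists p, q.
Qed.

Lemma shift_fixed x y z p : shift (x, y, z) p = p ->
  shx x%:~R p = shy (- y)%:~R (shz (- z)%:~R p).
Proof.
by rewrite -shift_x -shift_yz => e; rewrite -{2}e shiftD tripleD add0r !addNr.
Qed.

Lemma shift_fixed_yz y z p : shift (0, y, z) p = p ->
  shy y%:~R p = shz (- z)%:~R p.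
Proof.
move=> e; have := shift_yz y 0 p; have := shift_yz 0 (- z) p.
rewrite shz0 shy0 => <- <-; rewrite -{2}e shiftD tripleD addr0 add0r addNr.
by [].
Qed.

Lemma intr_neq0 (i : int) : [pchar K] =i pred0 -> i != 0 -> i%:~R != 0 :> K.
Proof.
move/pcharf0P => K0; case: i => [i|i] i0; first by rewrite -pmulrn K0.
by rewrite NegzE mulrNz oppr_eq0 -pmulrn K0.
Qed.

(** One obstruction per coordinate. Modulo the period the [x] component lies below [m], and
    minimality of [m] makes it 0; [d_noyz] then kills the [y] component; a pure [z] shift fixing [d]
    is trivial because [d] has positive degree in [z] and the characteristic is 0. *)
Lemma shift_stabilizer (d : Pxyz K) (m : nat) (n k : int) :
  [pchar K] =i pred0 -> irreducible_elt d -> (1 < size d)%N -> (0 < m)%N ->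
  shift (m%:Z, - n, - k) d = d ->
  (forall (m' : nat) (n' k' : int), (0 < m')%N ->
     shx m'%:R d = shy n'%:~R (shz k'%:~R d) -> (m <= m')%N) ->
  (forall n1 k1 : int, 0 < n1 -> shy n1%:~R d <> shz k1%:~R d) ->
  forall w, divides d (shift w d) -> exists q : int, w = (m%:Z, - n, - k) *~ q.
Proof.
move=> K0 d_irr sd m0 d_per m_min d_noyz w dw.
have {dw} e : shift w d = d.
  apply/esym/associate_irreducible_eq => //; last by rewrite [in RHS]lead_coef3_sh.
  exact: (irreducible_act shift0 shiftD).
case: w e => [[x y] z] e; exists (x %/ m)%Z; set q := (x %/ m)%Z.
have := act_fixed_eq shift0 shiftD (etrans e (esym (act_fixed_mulz shift0 shiftD q d_per))).
rewrite tripleMz tripleN tripleD !mulNr !opprK.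
have -> : x - m%:Z * q = (x %% m)%Z by rewrite /q {1}(divz_eq x m) mulrC addrC addKr.
set y' := y + _; set z' := z + _ => {}e.
have s0 : (x %% m)%Z = 0.
  apply/eqP; apply: contraT => s0.
  have : 0 <= (x %% m)%Z by apply: modz_ge0; rewrite -lt0n in m0 *; lia.
  have : (x %% m)%Z < m%:Z by apply: ltz_pmod.
  case: (x %% m)%Z s0 e => // s s0 e sm _.
  have := m_min s (- y') (- z'); rewrite lt0n => /(_ s0 (shift_fixed e)).
  by rewrite leqNgt -ltz_nat sm.
rewrite s0 in e.
have y0 : y' = 0.
  (* [d_noyz] speaks of positive [n1]; the other sign follows by the inverse shift. *)
  have pos i j : shift (0, i, j) d = d -> i <= 0.
    by move=> /shift_fixed_yz eij; rewrite leNgt; apply/negP => /d_noyz; apply; exact: eij.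
  apply/eqP; rewrite eq_le (pos _ _ e) /= -oppr_le0.
  by apply: (pos _ (- z')); rewrite -{1}e shiftD tripleD addr0 !addNr; apply: shift0.
rewrite y0 in e.
have z0 : z' = 0.
  apply/eqP; apply: contraT => z0; move: e; rewrite shift_yz shy0 => e.
  move: sd; rewrite ltnNge (@comp_shift_fixed (Pxy K) (z'%:~R)%:P%:P) //.
    by do 2!apply: pchar0_poly.
  by rewrite !polyC_eq0 intr_neq0.
rewrite {1}(divz_eq x m) s0 addr0 -/q mulrC.
have -> : y = - (n * q) by apply/eqP; rewrite -addr_eq0 -y0.
by have -> : z = - (k * q) by apply/eqP; rewrite -addr_eq0 -z0.
Qed.

(** Shifts in [z] act trivially on [c], and a vector fixing [c] may be negated, so [q] can be
    replaced by its absolute value, the [t] of the hypothesis. *)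
Lemma shift_polyC_not_fixed (c : Pxy K) (m : nat) (n k : int) :
  (forall t : nat, (0 < t)%N ->
    shx (t * m)%:R c%:P <> shy (t%:Z * n)%:~R (c%:P : Pxyz K)) ->
  irreducible_elt c ->
  forall q : int, q != 0 -> ~ divides c%:P (shift ((m%:Z, - n, - k) *~ q) c%:P).
Proof.
move=> c_free c_irr q q0 dq; have ci := irreducible_Pxy c_irr.
have {dq} e : shift ((m%:Z, - n, - k) *~ q) c%:P = c%:P.
  apply/esym/associate_irreducible_eq => //; last by rewrite [in RHS]lead_coef3_sh.
  exact: (irreducible_act shift0 shiftD).
have q_gt0 : (0 < `|q|)%N by rewrite absz_gt0.
apply: (c_free _ q_gt0).
have := act_fixed_mulz shift0 shiftD (Num.sg q) e.
rewrite -mulrzA [q * _]mulrC -normrEsg -abszE tripleMz => /shift_fixed.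
rewrite [shz _ _]comp_polyC mulNr opprK [n * _]mulrC => <-.
by rewrite [(_ * m)%N]mulnC pmulrn PoszM.
Qed.

End RationalFunctions.

(** * The abstract argument applied to the shifts of [K[x,y,z]] *)

Theorem theorem6p4 (K : fieldType) (charK0 : [pchar K] =i pred0)
  (lambda : nat) (lambda_gt0 : (0 < lambda)%N)
  (d : Pxyz K) (d_irr : irreducible_elt d)
  (m : nat) (n k : int) (m_gt0 : (0 < m)%N)
  (d_mnk : shx m%:R d = shy n%:~R (shz k%:~R d))
  (m_min : forall (m' : nat) (n' k' : int), (0 < m')%N ->
     shx m'%:R d = shy n'%:~R (shz k'%:~R d) -> (m <= m')%N)
  (d_noyz : forall n1 k1 : int, 0 < n1 -> shy n1%:~R d <> shz k1%:~R d)
  (I : nat) (mi : 'I_I -> nat) (b : 'I_I -> nat -> Pxyz K) (c : 'I_I -> Pxy K)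
  (c_irr : forall i, irreducible_elt (c i))
  (c_inj : injective c)
  (b_degz : forall i l, (1 <= l <= mi i)%N -> (size (b i l) < size d)%N)
  (b_degy : forall i l, (1 <= l <= mi i)%N -> (sizey (b i l) < size (c i))%N)
  (c_noshift : forall i (t : nat), (0 < t)%N ->
     shx (t * m)%:R (c i)%:P <> shy ((t%:Z * n)%:~R) (c i)%:P) :
  let r : Fxyz K := ((d%:F) ^+ lambda)^-1 *
    \sum_(i < I) \sum_(1 <= l < (mi i).+1) (b i l)%:F / ((c i)%:P%:F) ^+ l in
  has_telescoper r <-> r = 0.
Proof.
move=> r.
have s0 i (l j : nat) : (1 <= l <= mi i)%N -> (size ((b i l)`_j)%R < size (c i))%N.
  by move=> /b_degy /sizey_ltP [_]; apply.
split=> [[ls [ls_Kx ls_neq0 [g [h summ]]]]|r0]; last first.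
  exists [:: 1]; split.
  - by move=> l; rewrite inE => /eqP ->; exists 1, 1; apply: (fraction1 (polyC \o polyC)).
  - by rewrite /= oner_neq0.
  - by exists 0, 0; rewrite /apply_op big_ord1 /= r0 mulr0 sigyE sigzE -(fract_coboundary0 (@shift0 K) (@shiftD K)).
pose a := \sum_(i < I) \sum_(1 <= l < (mi i).+1) (b i l)%:F / ((c i)%:P%:F) ^+ l.
have era : r = a / d%:F ^+ lambda by rewrite mulrC.
suff a0 : a = 0 by rewrite era a0 mul0r.
(* If [d] is free of [z], the bound on the degree in [z] makes every numerator 0. *)
have [sd|sd] := leqP (size d) 1.
  rewrite /a big1 // => i _; rewrite big_nat big1 // => l li.
  have := leq_trans (b_degz i l li) sd; rewrite ltnS size_poly_leq0 => /eqP ->.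
  by rewrite tofrac0 mul0r.
have c_neq0 i : c i != 0 by have [] := c_irr i.
(* Those [c i] free of [y] are left out: their numerators vanish, and poles are followed only along
   primes of positive degree in [y]. *)
pose C x := exists2 i, x = c i & (1 < size (c i))%N.
have C_prime x : C x -> x != 0 /\ prime_elt x.
  case=> i -> _; split=> //.
  by have [mu [_ _ pr]] := ufd_Pxy K; apply/pr/c_irr.
have d_per : shift K (m%:Z, - n, - k) d = d.
  have e : shift K (m%:Z, 0, 0) d = shift K (0, n, k) d.
    by rewrite shift_x shift_yz -d_mnk -pmulrn.
  have := act_fixed_eq (@shift0 K) (@shiftD K) e.
  by rewrite tripleN tripleD oppr0 addr0 !add0r.
apply: (@no_telescoper {poly K} (shift K) (@sh2 K) (@shift0 K) (@shiftD K)
  (@size_sh K) (@sh_polyC K) (@size_sh2 K) _ (@ufd_Pxyz K) d lambda m n k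
  d_irr sd lambda_gt0 m_gt0 d_per _ C C_prime _ _ a ls g h _ _ _ ls_neq0).
- by move=> i j u; rewrite shift_polyCC comp_shift0.
- exact: shift_stabilizer charK0 d_irr sd m_gt0 d_per m_min d_noyz.
- by move=> x [i ->].
- move=> x q [i -> _]; apply: shift_polyC_not_fixed; last exact: c_irr.
  exact: c_noshift.
- by apply: proper_frac_sum; [apply: ltnW|exact: c_neq0|exact: b_degz].
- apply: coef_proper_sum; [by move=> x /C_prime []| |exact: s0].
  by move=> i sci; exists i.
- by move=> l /ls_Kx /in_Kx_const_fraction.
rewrite -era -sigyE -sigzE -summ; apply: eq_bigr => j _.
by rewrite iter_sigx.
Qed.
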